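(* Let $H$ be an even positive integer, $m\ge1$ and $S\ge 1$ integers, and let $\mathbb S_{\rm esc}$ be an equiangular sub-symmetric constellation with $H\cdot S$ points, generated by the set $\mathbb S_H=\{p_1,\dots,p_S\}$. Let $G=\frac{m!}{2}H^{m+1}$. Let $\mathcal A$ be the number of ordered pairs $(u,v)\in\{1,\dots,S\}^2$ with $r_u\ne r_v$, and let $\mathcal B$ be the number of ordered pairs $(u,v)\in\{1,\dots,S\}^2$ with $r_u=r_v$ and $|\psi_u|\neq|\psi_v|$. (i) (Case $N=1$.) There are at least $\big((S^2-S)m+\mathcal A+\mathcal B+S\big)\,G$ distinct complementary sequences of length $2^m$ all of whose elements lie in $\mathbb S_{\rm esc}$. (ii) (Case $N>1$.) For every Golay complementary pair $(\mathbf a,\mathbf b)$ of length $N>1$ such that $\mathbf a\ne\kappa\mathbf b$ for all $\kappa\in\mathbb C$, there are at least $2\big((S^2-S)m+S\big)\,G$ distinct complementary sequences of length $N2^m$ that are concatenations of $2^m$ blocks of length $N$, each block being an element of $\mathbb S_{\rm esc}$ times $\mathbf a$ or $\mathbf b$.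
   Context: For a complex sequence $\mathbf a=(a_0,\dots,a_{N-1})$ with $a_{N-1}\neq 0$, the aperiodic autocorrelation is $\rho_{\mathbf a}(k)=\sum_{i=0}^{N-k-1}a_i^*a_{i+k}$ for $0\le k\le N-1$, with $\rho_{\mathbf a}(-k)=\rho_{\mathbf a}(k)^*$. A pair $(\mathbf a,\mathbf b)$ of sequences of length $N$ is a Golay complementary pair if $\rho_{\mathbf a}(k)+\rho_{\mathbf b}(k)=0$ for all $k\ne0$; each member of such a pair is called a complementary sequence. Equiangular sub-symmetric constellation: let $\mathbb S_H=\{p_1,\dots,p_S\}$ be a set of $S$ distinct nonzero complex numbers. Write $p_u=r_ue^{\mathrm j(\psi_u+\pi/4)}$, where $r_u=|p_u|>0$ is the amplitude and $\psi_u$ is the phase of $p_u$ minus $\pi/4$ (with $\mathrm j=\sqrt{-1}$). It is required that $-\pi/H<\psi_u\le\pi/H$ for all $u$ and that whenever $|\psi_u|<\pi/H$, the mirror image $\mathrm j p_u^*=r_ue^{\mathrm j(\pi/4-\psi_u)}$ of $p_u$ with respect to the line $y=x$ also belongs to $\mathbb S_H$. The constellation is $\mathbb S_{\rm esc}=\{p_u e^{\mathrm j2\pi k/H}: p_u\in\mathbb S_H,\ k\in\{0,1,\dots,H-1\}\}$. *)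

(* Defs.v *)
From HB Require Import structures.
From mathcomp Require Export all_boot all_order all_algebra.
From mathcomp Require Export all_classical all_reals all_analysis.
From mathcomp Require Export complex.

Set Implicit Arguments.
Unset Strict Implicit.
Unset Printing Implicit Defensive.
Export Order.TTheory GRing.Theory Num.Theory.

Local Open Scope classical_set_scope.
Local Open Scope ring_scope.

Section Golay.
Variable R : realType.
Implicit Types (a b c : seq R[i]) (N : nat).

(* The sum is empty, hence 0, for lags k >= size a. *)
Definition autocorr_nat a (k : nat) : R[i] :=
  \sum_(i < size a - k) (a`_i)^* * a`_(i + k).

(* Negz n stands for the integer - (n + 1). *)
Definition autocorr a (k : int) : R[i] :=
  match k with
  | Posz n => autocorr_nat a n
  | Negz n => (autocorr_nat a n.+1)^*
  end.

(* For N = 0 the last condition fails (a`_0 = 0), so N > 0 is implied. *)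
Definition is_sequence N a := size a = N /\ a`_N.-1 != 0.

Definition golay_pair N a b :=
  [/\ is_sequence N a, is_sequence N b &
      forall k : int, k != 0 -> autocorr a k + autocorr b k = 0].

(* golay_pair is symmetric in its two sequences, so being the first component
   of a pair is the same as being a member of one. *)
Definition complementary N a := exists b, golay_pair N a b.

(* c is the concatenation of nb blocks, each one an element of E times a or b. *)
Definition block_concatenation (E : set R[i]) a b (nb : nat) c :=
  exists blocks : seq (seq R[i]),
    [/\ size blocks = nb, c = flatten blocks &
        forall x, x \in blocks ->
          exists2 z, E z & x = [seq z * y | y <- a] \/ x = [seq z * y | y <- b]].

End Golay.

Section Constellation.
Variable R : realType.

Definition expj (t : R) : R[i] := (cos t +i* sin t)%C.

(* For H >= 1, r and psi are determined by p: r u is the amplitude of p u, and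
   psi u, normalized to ]- pi / H, pi / H], is its phase minus pi / 4. *)
Definition equiangular_subsymmetric (H S : nat)
    (p : 'I_S -> R[i]) (r psi : 'I_S -> R) :=
  [/\ injective p,
      forall u, p u != 0 /\ `|p u| = (r u)%:C%C,
      forall u, p u = (r u)%:C%C * expj (psi u + pi / 4),
      forall u, - (pi / H%:R) < psi u <= pi / H%:R &
      forall u, `|psi u| < pi / H%:R -> exists v, p v = 'i%C * (p u)^*].

Definition constellation (H S : nat) (p : 'I_S -> R[i]) : set R[i] :=
  [set z | exists u (k : 'I_H), z = p u * expj (2 * pi * k%:R / H%:R)].

Definition num_diff_amp (S : nat) (r : 'I_S -> R) : nat :=
  #|[pred uv : 'I_S * 'I_S | r uv.1 != r uv.2]|.

Definition num_diff_phase (S : nat) (r psi : 'I_S -> R) : nat :=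
  #|[pred uv : 'I_S * 'I_S |
      (r uv.1 == r uv.2) && (`|psi uv.1| != `|psi uv.2|)]|.

End Constellation.

(* The division by 2 is exact when H is even. *)
Definition golay_count (m H : nat) : nat := (m`! * H ^ m.+1) %/ 2.

(* Main.v *)
(** If (P, Q) is a Golay pair and M is a scaled unitary 2 x 2 matrix, then so are
the rows of M applied to P and to a shift of Q. Iterating with the shifts N * 2 ^ l
taken in the order given by a permutation pi of the m bit positions yields a pair of
sequences of length N * 2 ^ m: with y_l the bit at position pi (l - 1) of the block
number, y_0 = 0 and y_(m+1) = 0 (1 for the second sequence), the block coefficient is
the product of the matrix entries M_l (y_(l+1), y_l). All matrices but one are taken
to be [[1, 1], [1, -1]], and the remaining one, at step n, is
[[p_u, p_v], [j p_v^*, - j p_u^*]]; rescaling by H-th roots of unity gives H ^ (m + 1)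
phases. Sub-symmetry of the constellation keeps all the coefficients in it.

The parameters are recovered from the coefficient function F. For bits i and j,
F {i, j} F 0 / (F i F j) is 1 if i and j are not adjacent on the path pi, and a
negative real (- 1 or - r_u ^ 2 / r_v ^ 2) if they are, so F determines the path up to
reversal. The orientation is fixed by the pattern of the blocks a and b when N > 1,
and is normalized when N = 1. The H-th powers of F 0 and F i, which forget the phases,
then determine u, n and v, and the phases follow. When N = 1, the step n = 0 is also
available, but coincides with other steps if p_u is, up to a phase, p_v or its
mirror image; this is where num_diff_amp and num_diff_phase come from. *)

Require Import Defs.
From mathcomp Require Import fingroup perm ring lra zify.

Set Implicit Arguments.
Unset Strict Implicit.
Unset Printing Implicit Defensive.

Local Open Scope classical_set_scope.
Local Open Scope card_scope.
Local Open Scope ring_scope.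

(** * Golay pairs in functional form and their iterated construction *)

Section GolayFamilies.
Variable C : numClosedFieldType.

(* The functional form, over arbitrary weights w of the lag, of the vanishing of the
   nontrivial autocorrelations of the pair (P false, P true). *)
Definition golay_family (I : finType) (pos : I -> int) (P : bool -> I -> C) :=
  exists K, forall w : int -> C,
    \sum_r \sum_i \sum_j (P r i)^* * P r j * w (pos j - pos i) = K * w 0.

Lemma golay_family_reindex (I J : finType) (h : J -> I)
    (pos : I -> int) (pos' : J -> int) (P : bool -> I -> C) P' :
  bijective h -> (forall j, pos' j = pos (h j)) ->
  (forall r j, P' r j = P r (h j)) ->
  golay_family pos P <-> golay_family pos' P'.
Proof.
move=> hbij posE PE.
suff eqs w : \sum_r \sum_i \sum_j (P r i)^* * P r j * w (pos j - pos i) =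
    \sum_r \sum_i \sum_j (P' r i)^* * P' r j * w (pos' j - pos' i).
  by split=> -[K HK]; exists K => w; rewrite -HK eqs.
apply: eq_bigr => r _; rewrite (reindex h) /=; last exact: onW_bij.
apply: eq_bigr => i _; rewrite (reindex h) /=; last exact: onW_bij.
by apply: eq_bigr => j _; rewrite !posE !PE.
Qed.

Lemma golay_family_scale (I : finType) (pos : I -> int) (P : bool -> I -> C) c :
  golay_family pos P -> golay_family pos (fun r i => c * P r i).
Proof.
case=> K HK; exists (c^* * c * K) => w; rewrite -mulrA -HK mulr_sumr.
apply: eq_bigr => r _; rewrite mulr_sumr; apply: eq_bigr => i _.
rewrite mulr_sumr; apply: eq_bigr => j _; rewrite rmorphM; ring.
Qed.

(* M is, up to a scalar, a unitary 2 x 2 matrix. *)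
Definition scaled_unitary (M : bool -> bool -> C) :=
  exists k, forall b b', \sum_r (M r b)^* * M r b' = k *+ (b == b').

(** The correlation of [P b] with [P b'] is weighted by the inner product of columns [b] and [b'] of
    [M]: cross terms vanish, and in the diagonal ones the two delays cancel, whatever [s] is. *)
Lemma golay_family_step (I : finType) (pos : I -> int) (P : bool -> I -> C)
    (s : int) (M : bool -> bool -> C) :
  scaled_unitary M -> golay_family pos P ->
  golay_family (fun bi : bool * I => pos bi.2 + bi.1%:R * s)
    (fun r bi => M r bi.1 * P bi.1 bi.2).
Proof.
case=> k Mk [K HK]; exists (k * K) => w.
pose X b b' := \sum_i \sum_j (P b i)^* * P b' j *
  w (pos j + b'%:R * s - (pos i + b%:R * s)).
transitivity (\sum_r \sum_b \sum_b' (M r b)^* * M r b' * X b b').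
  apply: eq_bigr => r _.
  rewrite -(pair_bigA _ (fun b i => \sum_bj (M r b * P b i)^* *
    (M r bj.1 * P bj.1 bj.2) * w (pos bj.2 + bj.1%:R * s - (pos i + b%:R * s)))) /=.
  apply: eq_bigr => b _; rewrite exchange_big.
  transitivity (\sum_i \sum_b' (M r b)^* * M r b' * \sum_j (P b i)^* * P b' j *
     w (pos j + b'%:R * s - (pos i + b%:R * s))); last first.
    by rewrite exchange_big; apply: eq_bigr => b' _; rewrite mulr_sumr.
  rewrite exchange_big; apply: eq_bigr => i _.
  rewrite -(pair_bigA _ (fun b' j => (M r b * P b i)^* *
    (M r b' * P b' j) * w (pos j + b'%:R * s - (pos i + b%:R * s)))) /=.
  apply: eq_bigr => b' _; rewrite mulr_sumr; apply: eq_bigr => j _.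
  rewrite rmorphM; ring.
rewrite exchange_big -mulrA -HK mulr_sumr; apply: eq_bigr => b _.
rewrite exchange_big (bigD1 b) //= -mulr_suml Mk eqxx mulr1n.
rewrite [X in _ + X]big1 ?addr0 => [|b' nb]; last first.
  by rewrite -mulr_suml Mk eq_sym (negbTE nb) mul0r.
congr (_ * _); apply: eq_bigr => i _; apply: eq_bigr => j _.
by congr (_ * w _); ring.
Qed.

(** Past the last coordinate the value is [r], so that the member of the final pair reads as one
    more coordinate, the row of the last matrix. *)
Definition ext_at (n : nat) (z : {ffun 'I_n -> bool}) (r : bool) (l : nat) : bool :=
  if insub l is Some o then z o else r.

Lemma ext_at_ord n (z : {ffun 'I_n -> bool}) r (o : 'I_n) : ext_at z r o = z o.
Proof. by rewrite /ext_at valK. Qed.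

Lemma ext_at_ge n (z : {ffun 'I_n -> bool}) r l : (n <= l)%N -> ext_at z r l = r.
Proof. by move=> nl; rewrite /ext_at insubN // -leqNgt. Qed.

Lemma ext_at_recr n (z : {ffun 'I_n.+1 -> bool}) r l : (l <= n)%N ->
  ext_at z r l =
  ext_at [ffun o : 'I_n => z (widen_ord (leqnSn n) o)] (z ord_max) l.
Proof.
rewrite leq_eqVlt => /orP[/eqP->|ln].
  by rewrite [RHS]ext_at_ge // -(ext_at_ord z r ord_max).
rewrite (_ : l = Ordinal ln) // ext_at_ord ffunE -(ext_at_ord z r).
by congr ext_at.
Qed.

(* The coordinate z l chooses, at step l, between the two members of the current
   pair; the second one is delayed by s l. *)
Lemma golay_family_path n (s : nat -> int) (M : nat -> bool -> bool -> C)
    (I : finType) (pos : I -> int) (P : bool -> I -> C) :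
  (forall l, (l < n)%N -> scaled_unitary (M l)) -> golay_family pos P ->
  golay_family
    (fun zi : {ffun 'I_n -> bool} * I => pos zi.2 + \sum_(l < n) (zi.1 l)%:R * s l)
    (fun r zi => \prod_(l < n) M l (ext_at zi.1 r l.+1) (zi.1 l)
                 * P (ext_at zi.1 r 0) zi.2).
Proof.
move=> + HP; elim: n => [_|n IH Mu].
  refine (proj1 (golay_family_reindex (h := snd) _ _ _) HP).
  - apply: inj_card_bij; last by rewrite card_prod card_ffun card_ord expn0 mul1n.
    by move=> [z i] [z' i'] /= ->; congr (_, _); apply/ffunP; case.
  - by move=> zi; rewrite big_ord0 addr0.
  - by move=> r zi; rewrite big_ord0 mul1r ext_at_ge.
have {}IH := IH (fun l ln => Mu l (ltnW ln)).
have {}IH := golay_family_step (s n) (Mu n (ltnSn n)) IH.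
(* The last coordinate is the one that the new step introduces. *)
pose h (zi : {ffun 'I_n.+1 -> bool} * I) :=
  (zi.1 ord_max, ([ffun o : 'I_n => zi.1 (widen_ord (leqnSn n) o)], zi.2)).
refine (proj1 (golay_family_reindex (h := h) _ _ _) IH).
- apply: inj_card_bij; last first.
    by rewrite !card_prod !card_ffun !card_ord card_bool expnS mulnA.
  move=> [z i] [z' i'] [] /= zm /ffunP zw ->; congr (_, _); apply/ffunP => o.
  have [om|om] := eqVneq o ord_max; first by rewrite om.
  have on : (o < n)%N.
    by have := ltn_ord o; rewrite ltnS leq_eqVlt -val_eqE in om *; rewrite (negbTE om).
  by have := zw (Ordinal on); rewrite !ffunE; congr (z _ = z' _); apply: val_inj.
- move=> zi; rewrite /h /= big_ord_recr /= addrA; congr (_ + _ + _).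
  by apply: eq_bigr => o _; rewrite ffunE.
- move=> r [z i]; rewrite /h /= big_ord_recr /= ext_at_ge // ext_at_recr //.
  rewrite mulrA [M n _ _ * _]mulrC; congr (_ * _ * _).
  by apply: eq_bigr => o _; rewrite ffunE ext_at_recr //=.
Qed.

End GolayFamilies.

(** * From families to sequences, by binary expansion of the block number *)

Section Sequences.
Variable R : realType.
Implicit Types (a b : seq R[i]) (N m : nat).

(** A Kronecker weight on the lag treats both signs of [k] alike and has the shape that
    [golay_family] tests. *)
Lemma autocorrE a (k : int) :
  autocorr a k = \sum_(i < size a) \sum_(j < size a)
    (a`_i)^* * a`_j * ((j%:Z - i%:Z) == k)%:R.
Proof.
have natE n : autocorr_nat a n = \sum_(i < size a) \sum_(j < size a)
    (a`_i)^* * a`_j * ((j%:Z - i%:Z) == n%:Z)%:R.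
  rewrite /autocorr_nat (big_ord_widen (size a) (fun i => (a`_i)^* * a`_(i + n)))
    ?leq_subr // big_mkcond; apply: eq_bigr => i _.
  have [lt|ge] := ltnP i (size a - n); last first.
    rewrite big1 // => j _; case: eqP => [e|]; last by rewrite mulr0.
    by exfalso; have := ltn_ord j; lia.
  have lt' : (i + n < size a)%N by lia.
  rewrite (bigD1 (Ordinal lt')) //= big1 => [|j].
    by rewrite addr0 (_ : (_ == _) = true) ?mulr1 //; lia.
  rewrite -val_eqE /= => ne; rewrite (_ : (_ == _) = false) ?mulr0 //; lia.
case: k => n /=; first exact: natE.
rewrite natE rmorph_sum exchange_big; apply: eq_bigr => i _.
rewrite rmorph_sum; apply: eq_bigr => j _.
rewrite !rmorphM /= conjCK rmorph_nat [_ * a`_i]mulrC; congr (_ * _%:R).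
by rewrite NegzE -eqr_oppLR opprB.
Qed.

(** The double sum is linear in the weight and only finitely many lags occur, so Kronecker weights
    suffice. *)
Lemma golay_family_seqP N a b : size a = N -> size b = N ->
  (forall k : int, k != 0 -> autocorr a k + autocorr b k = 0) <->
  golay_family (fun i : 'I_N => i%:Z) (fun r i => (if r then b else a)`_i).
Proof.
move=> sa sb; pose A (w : int -> R[i]) := \sum_(r : bool) \sum_(i < N) \sum_(j < N)
  ((if r then b else a)`_i)^* * (if r then b else a)`_j * w (j%:Z - i%:Z).
have AE k : autocorr a k + autocorr b k = A (fun l => (l == k)%:R).
  by rewrite /A big_bool /= addrC !autocorrE sa sb.
split=> [H|[K HK] k k0]; last first.
  by rewrite AE; apply: etrans (HK _) _; rewrite eq_sym (negbTE k0) mulr0.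
exists (A (fun l => (l == 0)%:R)) => w; rewrite -/(A w).
(* Shifting by [N] numbers the lags from - N to N - 1 by naturals; lag 0 gets number [N]. *)
have wE (i j : 'I_N) : w (j%:Z - i%:Z) =
    \sum_(k < N.*2) w (k%:Z - N%:Z) * (j%:Z - i%:Z == k%:Z - N%:Z)%:R.
  have ij : (N + j - i < N.*2)%N by have := ltn_ord i; have := ltn_ord j; lia.
  rewrite (bigD1 (Ordinal ij)) //= big1 => [|k].
    have -> : (N + j - i)%N%:Z - N%:Z = j%:Z - i%:Z by have := ltn_ord i; lia.
    by rewrite eqxx mulr1 addr0.
  rewrite -val_eqE /= => ne; rewrite (_ : (_ == _) = false) ?mulr0 //.
  by have := ltn_ord i; lia.
have -> : A w = \sum_(k < N.*2) w (k%:Z - N%:Z) * A (fun l => (l == k%:Z - N%:Z)%:R).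
  rewrite /A; under [RHS]eq_bigr do rewrite mulr_sumr.
  rewrite [RHS]exchange_big; apply: eq_bigr => r _.
  under [RHS]eq_bigr do rewrite mulr_sumr.
  rewrite [RHS]exchange_big; apply: eq_bigr => i _.
  under [RHS]eq_bigr do rewrite mulr_sumr.
  rewrite [RHS]exchange_big; apply: eq_bigr => j _.
  by rewrite wE mulr_sumr; apply: eq_bigr => k _; rewrite mulrCA.
have [N0|N_gt0] := posnP N.
  rewrite big1 => [|k _]; last by exfalso; have := ltn_ord k; rewrite [X in (_ < X.*2)%N]N0.
  rewrite /A big1 ?mul0r // => r _; rewrite big1 // => i.
  by exfalso; have := ltn_ord i; rewrite [X in (_ < X)%N]N0.
have NN : (N < N.*2)%N by lia.
rewrite (bigD1 (Ordinal NN)) //= subrr mulrC big1 ?addr0 // => k.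
rewrite -val_eqE /= => kN; rewrite -AE H ?mulr0 //; lia.
Qed.

Lemma golay_pairP N a b : (0 < N)%N -> size a = N -> size b = N ->
  a`_N.-1 != 0 -> b`_N.-1 != 0 ->
  golay_pair N a b <->
  golay_family (fun i : 'I_N => i%:Z) (fun r i => (if r then b else a)`_i).
Proof.
move=> N0 sa sb a0 b0; rewrite -golay_family_seqP //.
by split=> [[]//|H]; split.
Qed.

Definition bits m (t : nat) : {ffun 'I_m -> bool} :=
  [ffun i => odd (t %/ 2 ^ (val i : nat))].

Lemma bits_sum m t : (t < 2 ^ m)%N -> (\sum_(i < m) bits m t i * 2 ^ i = t)%N.
Proof.
under eq_bigr do rewrite ffunE.
elim: m t => [|m IH] t; first by rewrite big_ord0 expn0; case: t.
rewrite expnS big_ord_recl expn0 divn1 muln1 => tm.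
rewrite -[RHS](odd_double_half t); congr (_ + _)%N.
rewrite -muln2 -[X in (_ = X * _)%N]IH; last by lia.
rewrite big_distrl /=; apply: eq_bigr => i _.
by rewrite /bump /= add1n expnS divnMA divn2 -mulnA [(2 * _)%N]mulnC.
Qed.

Lemma bits_onto m (x : {ffun 'I_m -> bool}) : exists2 t, (t < 2 ^ m)%N & bits m t = x.
Proof.
have inj : injective (fun t : 'I_(2 ^ m) => bits m t).
  by move=> s t e; apply/val_inj; rewrite /= -(bits_sum (ltn_ord s)) -(bits_sum (ltn_ord t)) /= e.
have [|g _ gK] := inj_card_bij inj; first by rewrite card_ffun card_ord card_bool card_ord.
by exists (g x) => //; apply: gK.
Qed.

Definition seq_of_family N m (g : {ffun 'I_m -> bool} -> nat -> R[i]) :=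
  mkseq (fun k => g (bits m (k %/ N)%N) (k %% N)%N) (N * 2 ^ m).

Lemma nth_seq_of_family N m g t i : (i < N)%N -> (t < 2 ^ m)%N ->
  (seq_of_family N g)`_(t * N + i) = g (bits m t) i.
Proof.
move=> iN tm; rewrite nth_mkseq.
  by rewrite divnMDl ?(leq_ltn_trans _ iN) // divn_small // addn0 modnMDl modn_small.
apply: (@leq_trans (t.+1 * N)); first by rewrite mulSn; lia.
by rewrite mulnC leq_mul2l tm orbT.
Qed.

Lemma seq_of_family_inj N m g h : seq_of_family N g = seq_of_family N h ->
  forall (x : {ffun 'I_m -> bool}) i, (i < N)%N -> g x i = h x i.
Proof.
move=> e x i iN; have [t tm <-] := bits_onto x.
by have := congr1 (nth 0 ^~ (t * N + i)%N) e; rewrite /= !nth_seq_of_family.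
Qed.

Lemma seq_of_family_flatten N m (g : {ffun 'I_m -> bool} -> nat -> R[i]) :
  (0 < N)%N -> seq_of_family N g =
  flatten [seq mkseq (g (bits m t)) N | t <- iota 0 (2 ^ m)].
Proof.
move=> N0; rewrite /seq_of_family /mkseq; elim: (2 ^ m)%N => [|n IH]; first by rewrite muln0.
rewrite mulnS addnC iotaD map_cat IH -addn1 iotaD map_cat flatten_cat.
congr cat; rewrite /= cats0 add0n -[X in iota X _]addn0 iotaDl -map_comp.
apply/eq_in_map => i; rewrite mem_iota /= => iN.
by rewrite mulnC divnMDl // divn_small // addn0 modnMDl modn_small.
Qed.

(** Bit [l] of the block number contributes [N * 2 ^ l] to the index of an entry, so the positions
    of the family are the indices of the sequence. *)
Lemma seq_of_family_golay N m (g : bool -> {ffun 'I_m -> bool} -> nat -> R[i]) :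
  (0 < N)%N -> (forall r x, g r x N.-1 != 0) ->
  golay_family (fun xi : {ffun 'I_m -> bool} * 'I_N =>
      xi.2%:Z + \sum_(l < m) (xi.1 l)%:R * (N * 2 ^ l)%N%:Z)
    (fun r xi => g r xi.1 xi.2) ->
  golay_pair (N * 2 ^ m) (seq_of_family N (g false)) (seq_of_family N (g true)).
Proof.
move=> N0 gN0 Hg; have L0 : (0 < N * 2 ^ m)%N by rewrite muln_gt0 N0 expn_gt0.
have last0 r : (seq_of_family N (g r))`_(N * 2 ^ m).-1 != 0.
  have -> : ((N * 2 ^ m).-1 = (2 ^ m).-1 * N + N.-1)%N.
    by have := expn_gt0 2 m; case: (2 ^ m)%N => // n _; rewrite mulnC mulSn; lia.
  by rewrite nth_seq_of_family ?prednK ?expn_gt0.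
apply/golay_pairP => //; rewrite ?size_mkseq //.
have kN (k : 'I_(N * 2 ^ m)) : (k %/ N < 2 ^ m)%N by rewrite ltn_divLR // [X in (_ < X)%N]mulnC.
refine (proj1 (golay_family_reindex
  (h := fun k : 'I_(N * 2 ^ m) => (bits m (k %/ N)%N, Ordinal (ltn_pmod k N0))) _ _ _) Hg).
- apply: inj_card_bij; last first.
    by rewrite card_prod card_ffun !card_ord card_bool mulnC.
  move=> s t [] e1 e2; apply: val_inj.
  by rewrite /= (divn_eq s N) (divn_eq t N) e2 -(bits_sum (kN s)) e1 bits_sum.
- move=> k /=; rewrite {1}(divn_eq k N) PoszD addrC; congr (_ + _).
  rewrite -{1}(bits_sum (kN k)) big_distrl (big_morph Posz PoszD erefl).
  apply: eq_bigr => l _; rewrite /= -mulnA [(_ * N)%N]mulnC PoszM.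
  by congr (_ * _); rewrite natz.
- by move=> [] k; rewrite nth_mkseq.
Qed.

End Sequences.

(** * Coefficients along a path with one marked matrix *)

Section PathCoefficients.
Variable R : realType.
Local Notation C := R[i].

Lemma conj_iC : ('i%C : C)^* = - 'i%C.
Proof. by apply/eqP; rewrite eq_complex /= oppr0 !eqxx. Qed.

Lemma iC_sqr : 'i%C * 'i%C = -1 :> C.
Proof. by rewrite -sqr_i expr2. Qed.

(** The reflection across the line y = x. *)
Definition mirror (z : C) : C := 'i%C * z^*.

Lemma mirrorK : involutive mirror.
Proof.
move=> z; rewrite /mirror rmorphM /= conjCK conj_iC mulrA mulrN iC_sqr opprK.
exact: mul1r.
Qed.

Lemma mirror_eq0 z : (mirror z == 0) = (z == 0).
Proof.
rewrite mulf_eq0 conjC_eq0 orb_idl // => /eqP i0.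
by have := iC_sqr; rewrite i0 mul0r => /eqP; rewrite eq_sym oppr_eq0 oner_eq0.
Qed.

(** Reflection conjugates inner products, which makes the columns of the marked matrix
    orthogonal. *)
Lemma mirror_inner z z' : (mirror z)^* * mirror z' = z * z'^*.
Proof.
rewrite /mirror rmorphM /= conjCK conj_iC mulrACA mulNr iC_sqr opprK.
by rewrite mul1r.
Qed.

(* The entry of the marked matrix in row r and column b, up to the sign bsign r b. *)
Definition mark (p q : C) (r b : bool) : C :=
  if r then mirror (if b then p else q) else if b then q else p.

Lemma mark_neq0 p q r b : p != 0 -> q != 0 -> mark p q r b != 0.
Proof. by case: r b => [] [] // p0 q0; rewrite mirror_eq0. Qed.

(** The 2 x 2 Hadamard matrix. *)
Definition bsign (r b : bool) : C := (-1) ^+ (r && b).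

Lemma scaled_unitary_col (M : bool -> bool -> C) (e : bool -> C) :
  (forall b, (e b)^* * e b = 1) -> scaled_unitary M ->
  scaled_unitary (fun r b => M r b * e b).
Proof.
move=> e1 [K HK]; exists K => b b'.
transitivity ((e b)^* * e b' * \sum_r (M r b)^* * M r b').
  by rewrite mulr_sumr; apply: eq_bigr => r _; rewrite rmorphM /=; ring.
by rewrite HK; have [<-|_] := eqVneq b b'; rewrite ?e1 ?mul1r // !mulr0n mulr0.
Qed.

Lemma scaled_unitary_bsign : scaled_unitary bsign.
Proof.
exists 2 => b b'; rewrite big_bool /bsign /=.
by case: b b' => [] [] /=; rewrite ?expr0 ?expr1 ?rmorphN1 ?rmorph1 ?mulr1n ?mulr0n; ring.
Qed.

Lemma scaled_unitary_mark p q :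
  scaled_unitary (fun r b => bsign r b * mark p q r b).
Proof.
exists (p^* * p + q^* * q) => b b'; rewrite big_bool /bsign /mark /=.
case: b b' => [] [] /=; rewrite ?expr0 ?expr1 ?mul1r ?mulN1r ?rmorphN /= ?mulrN ?mulNr ?opprK
  mirror_inner ?mulr1n ?mulr0n; ring.
Qed.

Section Coefficients.
Variables (m : nat) (w : C).
Implicit Types (x : {ffun 'I_m -> bool}) (pi : {perm 'I_m}).

(* y_l of the header; r is the value of y_(m+1). *)
Definition path_bit pi x (r : bool) (l : nat) : bool :=
  if l is l'.+1 then ext_at [ffun o => x (pi o)] r l' else false.

(** The sign of the marked matrix stays in the product. For n = 0 the mark belongs to the initial
    pair instead of a matrix. *)
Definition coef pi (n : nat) (p q : C) (k0 : nat) (k : nat -> nat) (r : bool) x : C :=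
  w ^+ k0 * (\prod_(l < m) (bsign (path_bit pi x r l.+2) (path_bit pi x r l.+1)
                            * w ^+ (k l * path_bit pi x r l.+1)))
  * mark p q (path_bit pi x r n.+1) (path_bit pi x r n).

(** The block is selected by y_1, which does not depend on the member when 0 < m; hence the fixed
    [false]. *)
Definition coef_seq N (a b : seq C) pi n p q k0 k r : seq C :=
  seq_of_family N (fun x i =>
    coef pi n p q k0 k r x * (if path_bit pi x false 1 then b else a)`_i).

Lemma path_bit1 pi x r : (0 < m)%N -> path_bit pi x r 1 = path_bit pi x false 1.
Proof. by move=> m0; rewrite /path_bit !(ext_at_ord _ _ (Ordinal m0)). Qed.

Hypothesis w_unit : w^* * w = 1.

Lemma root_neq0 : w != 0.
Proof. by apply: contra_eq_neq w_unit => ->; rewrite mulr0 eq_sym oner_eq0. Qed.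

Lemma coef_neq0 pi n p q k0 k r x : p != 0 -> q != 0 -> coef pi n p q k0 k r x != 0.
Proof.
move=> p0 q0; rewrite !mulf_neq0 ?expf_neq0 ?root_neq0 ?mark_neq0 //.
apply/prodf_neq0 => l _.
by rewrite mulf_neq0 ?expf_neq0 ?root_neq0 ?oppr_eq0 ?oner_eq0.
Qed.

Lemma coef_seq_golay N a b pi n p q k0 k : (0 < m)%N -> (0 < N)%N -> (n <= m)%N ->
  (n = 0 -> N = 1)%N -> p != 0 -> q != 0 -> golay_pair N a b ->
  golay_pair (N * 2 ^ m) (coef_seq N a b pi n p q k0 k false)
                         (coef_seq N a b pi n p q k0 k true).
Proof.
move=> m0 N0 nm nN p0 q0 ab; have [[sa a0] [sb b0] _] := ab.
apply: (seq_of_family_golay (g := fun r x i => coef pi n p q k0 k r x *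
  (if path_bit pi x false 1 then b else a)`_i)) => //.
  by move=> r x; rewrite mulf_neq0 ?coef_neq0 //; case: ifP.
have ew j b' : (w ^+ (j * b'))^* * w ^+ (j * b') = 1.
  by rewrite rmorphXn -exprMn w_unit expr1n.
pose M (l : nat) (r b' : bool) : C := bsign r b' *
  (if l.+1 == n then mark p q r b' else 1) * w ^+ (k l * b').
pose P (b' : bool) (i : 'I_N) : C :=
  w ^+ k0 * ((if n == 0%N then mark p q b' false else 1) * (if b' then b else a)`_i).
have Mu l : (l < m)%N -> scaled_unitary (M l).
  move=> _; apply: scaled_unitary_col => [b'|]; first exact: ew.
  case: eqP => _; first exact: scaled_unitary_mark.
  have [K HK] := scaled_unitary_bsign.
  by exists K => b1 b2; rewrite -HK; apply: eq_bigr => r _; rewrite !mulr1.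
have HP : golay_family (fun i : 'I_N => i%:Z) P.
  apply: golay_family_scale; have [n0|n0] := eqVneq n 0%N; last first.
    have [K HK] := proj1 (golay_pairP N0 sa sb a0 b0) ab.
    exists K => h; rewrite -HK; apply: eq_bigr => r _; apply: eq_bigr => i _.
    by apply: eq_bigr => j _; rewrite !mul1r.
  (* At length 1 the only lag is 0, so any two constants form a Golay family; this is what permits a
     mark at n = 0. *)
  move: P Mu a0 b0 sa sb ab => _ _ _ _ _ _ _; rewrite (nN n0).
  eexists => h; under eq_bigr do rewrite !big_ord1 subrr.
  by rewrite -mulr_suml.
(* Step [o] decides the bit [pi o], whose weight in the index is [N * 2 ^ pi o]. *)
pose shift l : int := (N * 2 ^ (if insub l is Some o then val (pi o) else 0%N))%N%:Z.
have HG := golay_family_path shift Mu HP; refine (proj1 (golay_family_reindex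
  (h := fun xi : {ffun 'I_m -> bool} * 'I_N =>
     ([ffun o => xi.1 (pi o)] : {ffun 'I_m -> bool}, xi.2)) _ _ _) HG).
- apply: inj_card_bij => // -[x i] [x' i'] [/ffunP e ->]; congr (_, _).
  by apply/ffunP => o; have := e ((pi^-1)%g o); rewrite !ffunE permKV.
- move=> [x i] /=; congr (_ + _); rewrite (reindex_inj (@perm_inj _ pi)) /=.
  by apply: eq_bigr => l _; rewrite ffunE /shift valK.
move=> r [x i] /=; rewrite /coef /P /M.
have -> : \prod_(l < m) (bsign (ext_at [ffun o => x (pi o)] r l.+1) ([ffun o => x (pi o)] l) *
   (if l.+1 == n then mark p q (ext_at [ffun o => x (pi o)] r l.+1) ([ffun o => x (pi o)] l) else 1)
   * w ^+ (k l * [ffun o => x (pi o)] l)) =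
   (\prod_(l < m) (bsign (path_bit pi x r l.+2) (path_bit pi x r l.+1)
                            * w ^+ (k l * path_bit pi x r l.+1))) *
   (if n == 0%N then 1 else mark p q (path_bit pi x r n.+1) (path_bit pi x r n)).
  under eq_bigr do rewrite mulrAC; rewrite big_split /=; congr (_ * _).
    by apply: eq_bigr => l _; rewrite /path_bit ext_at_ord.
  case: n nm {nN M P Mu HP HG} => [|n] nm /=; first by rewrite big1.
  rewrite (bigD1 (Ordinal nm)) //= eqxx big1 ?mulr1 => [|l].
    by rewrite -(ext_at_ord _ r (Ordinal nm)).
  by rewrite -val_eqE /= eqSS => /negbTE ->.
have e1 := path_bit1 pi x r m0; rewrite /path_bit /= in e1 *.
by rewrite e1; case: eqP => [->|_] /=; rewrite ?e1; ring.
Qed.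

(** * Values at block numbers with at most two bits set *)

#[local] Arguments path_bit : simpl never.

Lemma path_bit_ffun pi (A : pred 'I_m) l :
  path_bit pi [ffun i => A i] false l = [exists a : 'I_m, (l == a.+1) && A (pi a)].
Proof.
rewrite /path_bit; case: l => [|l]; first by apply/esym/existsP => -[].
rewrite /ext_at; case: (@insubP _ _ 'I_m l) => [a _ <-|ln].
  rewrite !ffunE; apply/idP/existsP => [Aa|[b /andP[/eqP[ab]]]].
    by exists a; rewrite eqxx.
  by have -> : a = b by apply: val_inj.
apply/esym/existsP => -[a /andP[/eqP[la]]].
by rewrite la ltn_ord in ln.
Qed.

Lemma path_bit_set0 pi l : path_bit pi [ffun=> false] false l = false.
Proof. by rewrite path_bit_ffun; apply/existsP => -[a]; rewrite andbF. Qed.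

Lemma path_bit_set1 pi a l : path_bit pi [ffun i => i == pi a] false l = (l == a.+1).
Proof.
rewrite (path_bit_ffun _ (pred1 (pi a))); apply/existsP/idP => [[b /=]|la].
  by rewrite (inj_eq perm_inj) => /andP[/eqP-> /eqP->].
by exists a; rewrite la /=.
Qed.

Lemma path_bit_set2 pi a b l :
  path_bit pi [ffun i => (i == pi a) || (i == pi b)] false l =
  (l == a.+1) || (l == b.+1).
Proof.
rewrite (path_bit_ffun _ (fun i => (i == pi a) || (i == pi b))).
apply/existsP/idP => [[c /=]|/orP[]/eqP->].
- by rewrite !(inj_eq perm_inj) => /andP[/eqP-> /orP[]/eqP->]; rewrite eqxx ?orbT.
- by exists a; rewrite !eqxx.
- by exists b; rewrite !eqxx orbT.
Qed.

Lemma coef_set0 pi n p q k0 k : coef pi n p q k0 k false [ffun=> false] = w ^+ k0 * p.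
Proof.
rewrite /coef !path_bit_set0 big1 ?mulr1 // => l _.
by rewrite !path_bit_set0 muln0 !expr0 mul1r.
Qed.

(** With a single bit set no two consecutive y are 1, so no sign appears. *)
Lemma coef_set1 pi n p q k0 k a :
  coef pi n p q k0 k false [ffun i => i == pi a] =
  w ^+ k0 * w ^+ k a * mark p q (n == a) (n == a.+1).
Proof.
rewrite /coef !path_bit_set1 eqSS; congr (_ * _ * _).
rewrite (bigD1 a) //= big1 ?mulr1 => [|l la]; rewrite !path_bit_set1 !eqSS.
  by rewrite eqxx muln1 (gtn_eqF (ltnSn a)) /bsign mul1r.
have /negbTE la' : (l != a :> nat) := la; by rewrite la' /bsign andbF muln0 mul1r.
Qed.

Lemma coef_set2 pi n p q k0 k (a b : 'I_m) : (a < b)%N ->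
  coef pi n p q k0 k false [ffun i => (i == pi a) || (i == pi b)] =
  w ^+ k0 * (w ^+ k a * w ^+ k b * (-1) ^+ (b == a.+1 :> nat))
  * mark p q ((n == a) || (n == b)) ((n == a.+1) || (n == b.+1)).
Proof.
move=> ab; rewrite /coef !path_bit_set2 !eqSS; congr (_ * _ * _).
have ba : b != a by rewrite -val_eqE /= gtn_eqF.
rewrite (bigD1 a) //= (bigD1 b) //= big1 ?mulr1 => [|l /andP[la lb]];
  rewrite !path_bit_set2 !eqSS.
  rewrite /bsign !eqxx orbT !muln1 andbT (gtn_eqF (ltnSn a)) /= [a.+1 == _]eq_sym.
  have -> : (b.+1 == a :> nat) = false by apply/eqP; lia.
  by rewrite (gtn_eqF (ltnSn b)) /= mul1r andbT [RHS]mulrC mulrA.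
have -> : (l == a :> nat) || (l == b :> nat) = false.
  by apply/norP; split.
by rewrite /bsign andbF muln0 mul1r.
Qed.

(** * Adjacency on the path and automorphisms of the path *)

Definition adjacent (a b : 'I_m) := (a.+1 == b :> nat) || (b.+1 == a :> nat).

(** Here [a] and [b] are positions on the path, carrying the bits [pi a] and [pi b]. The powers of
    [w] cancel and the marks contribute a positive ratio, equal to 1 off adjacency, so the sign -1
    of adjacent bits decides. *)
Lemma coef_adjacent pi n p q k0 k a b : p != 0 -> q != 0 -> a != b ->
  let F := coef pi n p q k0 k false in
  (F [ffun i => (i == pi a) || (i == pi b)] * F [ffun=> false] !=
   F [ffun i => i == pi a] * F [ffun i => i == pi b]) = adjacent a b.
Proof.
move=> p0 q0 + F; wlog ab : a b / (a < b)%N => [hw|_].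
  move=> ne; have [lt|gt|/val_inj e] := ltngtP a b; first exact: hw.
    have -> : [ffun i => (i == pi a) || (i == pi b)] =
              [ffun i => (i == pi b) || (i == pi a)].
      by apply/ffunP => i; rewrite !ffunE orbC.
    by rewrite [X in _ != X]mulrC hw // 1?eq_sym // /adjacent orbC.
  by rewrite e eqxx in ne.
rewrite /F coef_set0 !coef_set1 coef_set2 // /adjacent.
set wa := w ^+ k a; set wb := w ^+ k b; set w0 := w ^+ k0.
have wne : w0 * wa * (w0 * wb) != 0 by rewrite !mulf_neq0 ?expf_neq0 ?root_neq0.
have -> : (b.+1 == a :> nat) = false by apply/eqP; lia.
rewrite orbF [a.+1 == _]eq_sym.
set t2 := mark p q (_ || _) _; set ta := mark p q (n == a) _.
set tb := mark p q (n == b) _.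
have -> : (w0 * (wa * wb * (-1) ^+ (b == a.+1 :> nat)) * t2 * (w0 * p) !=
    w0 * wa * ta * (w0 * wb * tb)) = ((-1) ^+ (b == a.+1 :> nat) * (t2 * p) != ta * tb).
  rewrite -[in RHS](inj_eq (mulfI wne)); congr (~~ (_ == _)); ring.
have [ba|ba] := eqVneq (b : nat) a.+1; last first.
  (* At most one of the two bits sits at y_n or y_(n+1), so one of [ta], [tb] is [p] and the other
     equals [t2]. *)
  rewrite expr0 mul1r; apply/negbTE; rewrite negbK; apply/eqP.
  rewrite /t2 /ta /tb /mark.
  case: (eqVneq n a) => [->|na].
    have -> : (a == b :> nat) = false by apply/eqP; lia.
    have -> : (a == a.+1 :> nat) = false by apply/eqP; lia.
    have -> : (a == b.+1 :> nat) = false by apply/eqP; lia.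
    by [].
  case: (eqVneq n b) => [->|nb] /=.
    rewrite (negbTE ba).
    have -> : (b == b.+1 :> nat) = false by apply/eqP; lia.
    by rewrite mulrC.
  case: (eqVneq n a.+1) => [->|na1] /=.
    by rewrite eqSS (_ : (a == b :> nat) = false) //; apply/eqP; lia.
  by case: eqP => _; rewrite // mulrC.
rewrite expr1 mulN1r; apply/eqP => e.
suff: 0 < ta * tb / (t2 * p).
  by rewrite -e mulNr mulfV ?mulf_neq0 ?mark_neq0 // oppr_gt0 ltr10.
have t20 : t2 != 0 by exact: mark_neq0.
(* For n = b both y_n and y_(n+1) are set and the ratio is |q|^2 / |p|^2; for any other n it is
   1. *)
have [nb|nb] := eqVneq n b.
  rewrite /ta /tb /t2 nb ba !eqxx /= !orbT /mark /=.
  have -> : (a.+1 == a :> nat) = false by apply/eqP; lia.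
  have -> : (a.+1 == a.+2 :> nat) = false by apply/eqP; lia.
  rewrite /mirror mulrCA -[_ * p]mulrA invfM mulrACA divff; last first.
    by apply: contraNneq p0 => i0; rewrite -(mirror_eq0 p) /mirror i0 mul0r.
  by rewrite mul1r [p^* * p]mulrC divr_gt0 // mul_conjC_gt0.
suff -> : ta * tb = t2 * p by rewrite divff ?ltr01 // mulf_neq0.
rewrite /t2 /ta /tb -ba (negbTE nb) /= orbF /mark.
have [na|na] := eqVneq n a.
  by rewrite na (_ : (a == b.+1 :> nat) = false) //; apply/eqP; lia.
by rewrite mulrC.
Qed.

(** Induction along the path: the next vertex goes to a neighbour of its fixed predecessor, and the
    other neighbour is already taken. *)
Lemma path_automorphism_fix (s : {perm 'I_m}) (o : 'I_m) :
  (forall a b, adjacent (s a) (s b) = adjacent a b) -> o = 0%N :> nat -> s o = o ->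
  s = 1%g.
Proof.
move=> adj o0 so; apply/permP => a; rewrite perm1.
have [t] := ubnP (a : nat); elim: t a => // t IH a at_.
case: a at_ => [[|a] am] at_ /=.
  by have -> : Ordinal am = o by apply: val_inj; rewrite /= o0.
rewrite /= in at_; have am' : (a < m)%N by lia.
have sa : s (Ordinal am') = Ordinal am' by apply: IH => /=; lia.
have := adj (Ordinal am') (Ordinal am); rewrite sa /adjacent /= eqxx /=.
move=> /orP[/eqP e|/eqP e]; first exact: val_inj.
have bm : (a.-1 < m)%N by lia.
have : s (Ordinal bm) = Ordinal bm by apply: IH => /=; lia.
have -> : Ordinal bm = s (Ordinal am) by apply: val_inj; rewrite /= -[in LHS]e.
by move/perm_inj/(congr1 (@nat_of_ord m)) => /= e'; lia.
Qed.

Definition path_end (a : 'I_m) := (a == 0%N :> nat) || (a.+1 == m).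

(** An end has at most one neighbour, while the two neighbours of an interior [s a] would have
    distinct preimages adjacent to [a]. *)
Lemma path_automorphism_end (s : {perm 'I_m}) a :
  (forall b c, adjacent (s b) (s c) = adjacent b c) -> path_end a -> path_end (s a).
Proof.
move=> adj ae; rewrite /path_end; apply/negPn/negP => /norP[s0 sm].
have lt1 : ((s a).-1 < m)%N by have := ltn_ord (s a); lia.
have lt2 : ((s a).+1 < m)%N by have := ltn_ord (s a); lia.
have := adj a ((s^-1)%g (Ordinal lt1)); have := adj a ((s^-1)%g (Ordinal lt2)).
rewrite !permKV {1 3}/adjacent /= prednK ?lt0n // !eqxx /= orbT => /esym e2 /esym e1.
have e : (s^-1)%g (Ordinal lt1) = (s^-1)%g (Ordinal lt2).
  move: ae e1 e2; rewrite /path_end /adjacent => ae e1 e2; apply: val_inj.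
  set c := (s^-1)%g _ in e1 *; set d := (s^-1)%g _ in e2 *.
  by have := ltn_ord c; have := ltn_ord d; rewrite /=; lia.
by have /(congr1 (@nat_of_ord m)) := perm_inj e; rewrite /=; lia.
Qed.

(** * Recovery of the parameters from the coefficients *)

Section Injectivity.
Variables (H S : nat) (p : 'I_S -> C).
Hypothesis w_order : w ^+ H = 1.
Hypothesis w_inj : forall k l, (k < H)%N -> (l < H)%N -> w ^+ k = w ^+ l -> k = l.
Hypothesis p_neq0 : forall u, p u != 0.
Hypothesis p_inj : forall u v, p u ^+ H = p v ^+ H -> u = v.

(* At n = 0 the mark only sees row r of the column b = 0, that is p u and
   mirror (p v); at n = m only row 0, so that u = v gives the constant mark. *)
Definition valid_mark (n : nat) (u v : 'I_S) : bool :=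
  if n == 0%N then [&& (1 < m)%N, u != v & mirror (p v) ^+ H != p u ^+ H]
  else (n == m) || (u != v).

Lemma mirror_expn z z' : z ^+ H = z' ^+ H -> mirror z ^+ H = mirror z' ^+ H.
Proof. by move=> e; rewrite /mirror !exprMn -!rmorphXn /= e. Qed.

Lemma rootX_expn l : (w ^+ l) ^+ H = 1.
Proof. by rewrite exprAC w_order expr1n. Qed.

(** Along the path the marks are [p u], except [p v] at position n - 1 and [mirror (p v)] at
    position n, where these exist. The first deviation gives n, except that 0 and 1 both deviate at
    position 0. *)
Lemma mark_inj n n' (u v v' : 'I_S) : (0 < m)%N -> (n <= m)%N -> (n' <= m)%N ->
  valid_mark n u v -> valid_mark n' u v' ->
  (forall a : 'I_m, mark (p u) (p v) (n == a) (n == a.+1) ^+ H =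
                    mark (p u) (p v') (n' == a) (n' == a.+1) ^+ H) ->
  n = n' /\ v = v'.
Proof.
move=> m0; wlog nn' : n n' v v' / (n <= n')%N => [hw|nm n'm].
  move=> nm n'm V V' e; have [le|/ltnW le] := leqP n n'; first exact: hw.
  by have [-> ->] := hw n' n v' v le n'm nm V' V (fun a => esym (e a)).
have val0 (k : nat) : (k <= m)%N -> (k > 0)%N -> exists2 a : 'I_m, a.+1 = k & a = k.-1 :> nat.
  move=> km k1; have h : (k.-1 < m)%N by lia.
  by exists (Ordinal h) => //; rewrite prednK.
have [<- V V' e|ne V V' e] := eqVneq n n'.
  split=> //; have [n0|n0] := posnP n.
    have := e (Ordinal m0); rewrite n0 /mark /= => /mirror_expn.
    by rewrite !mirrorK; apply: p_inj.
  have [a ea ea'] := val0 n nm n0.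
  have := e a; rewrite /mark ea eqxx (_ : (n == a) = false); last by apply/eqP; lia.
  exact: p_inj.
have lt : (n < n')%N by lia.
have [n0|n0] := posnP n; last first.
  have [a ea ea'] := val0 n nm n0.
  have := e a; rewrite /mark ea eqxx (_ : (n == a) = false); last by apply/eqP; lia.
  rewrite (_ : (n' == a) = false); last by apply/eqP; lia.
  rewrite (_ : (n' == n) = false); last by apply/eqP; lia.
  move/p_inj => vu; move: V; rewrite /valid_mark vu eqxx /= orbF.
  by case: eqP => [|_ /eqP]; lia.
move: V; rewrite /valid_mark n0 /= => /and3P[m1 uv nvu].
have := e (Ordinal m0); rewrite n0 /mark /=.
have -> : (n' == 0%N) = false by apply/eqP; lia.
have [n1|n1] := eqVneq n' 1%N; last by move=> ev; rewrite ev eqxx in nvu.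
(* Up to phases, position 0 identifies [mirror (p v)] with [p v'], and position 1 identifies [p u]
   with [mirror (p v')]; reflecting gives u = v. *)
have := e (Ordinal m1); rewrite n0 n1 /mark /= => e1 e0.
have := mirror_expn e0; rewrite mirrorK -e1 => /p_inj vu.
by rewrite vu eqxx in uv.
Qed.

(** The adjacency test makes [s] an automorphism of the path; [orient] excludes the reversal, by a
    common first bit or by a common normalization of the ends. *)
Lemma coef_inj pi n u v k0 (k : nat -> nat) pi' n' u' v' k0' (k' : nat -> nat) (o : 'I_m) :
  (n <= m)%N -> (n' <= m)%N -> valid_mark n u v -> valid_mark n' u' v' ->
  (k0 < H)%N -> (k0' < H)%N ->
  (forall a : 'I_m, (k a < H)%N) -> (forall a : 'I_m, (k' a < H)%N) ->
  (forall x, coef pi n (p u) (p v) k0 k false x =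
             coef pi' n' (p u') (p v') k0' k' false x) ->
  o = 0%N :> nat ->
  pi o = pi' o \/ ((pi o < pi (rev_ord o))%N /\ (pi' o < pi' (rev_ord o))%N) ->
  [/\ pi = pi', n = n', u = u', v = v' &
      k0 = k0' /\ (forall a : 'I_m, k a = k' a)].
Proof.
move=> nm n'm V V' k0H k0'H kH k'H e o0 orient.
have m0 : (0 < m)%N by rewrite -o0 ltn_ord.
pose s := (pi * pi'^-1)%g.
have pis a : pi' (s a) = pi a by rewrite permM permKV.
have adj a b : adjacent (s a) (s b) = adjacent a b.
  have [<-|ab] := eqVneq a b; first by rewrite /adjacent; lia.
  have sab : s a != s b by rewrite (inj_eq perm_inj).
  rewrite -(coef_adjacent pi' n' k0' k' (p_neq0 u') (p_neq0 v') sab).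
  by rewrite !pis -!e coef_adjacent.
have epi : pi = pi'.
  suff so : s o = o by apply/permP => a; rewrite -pis (path_automorphism_fix adj o0 so) perm1.
  case: orient => [poo|[lt lt']]; first by apply: (@perm_inj _ pi'); rewrite pis.
  have eo : path_end o by rewrite /path_end o0.
  have er : path_end (rev_ord o) by rewrite /path_end /= o0 subn1 prednK // eqxx orbT.
  have := path_automorphism_end adj eo; have := path_automorphism_end adj er.
  rewrite -!pis in lt; rewrite /path_end.
  have ends (c : 'I_m) : c.+1 == m -> c = rev_ord o.
    by move=> /eqP cm; apply: val_inj; rewrite /= o0; lia.
  have start (c : 'I_m) : c == 0%N :> nat -> c = o.
    by move=> /eqP cm; apply: val_inj; rewrite /= o0.
  (* If [s] swapped the ends, the two inequalities on the end bits would be opposite. *)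
  move=> /orP[/start sr|sr] /orP[/start so //|/ends so].
    by rewrite sr so in lt; have := ltn_trans lt lt'; rewrite ltnn.
  by rewrite (ends _ sr) so ltnn in lt.
subst pi'.
have := e [ffun=> false]; rewrite !coef_set0 => e0.
(* H-th powers erase the powers of [w]. *)
have uu : u = u'.
  by apply: p_inj; have := congr1 (fun z => z ^+ H) e0; rewrite !exprMn !rootX_expn !mul1r.
subst u'.
have kk0 : k0 = k0' by apply: w_inj => //; apply: (mulIf (p_neq0 u)).
have e1 a := e [ffun i => i == pi a].
have [nn vv] : n = n' /\ v = v'.
  apply: (@mark_inj n n' u) => // a; have := congr1 (fun z => z ^+ H) (e1 a).
  by rewrite !coef_set1 !exprMn !rootX_expn !mul1r.
subst n' v'; split=> //; split=> // a; apply: w_inj => //.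
have := e1 a; rewrite !coef_set1 -kk0 => /mulIf h.
apply: (@mulfI _ (w ^+ k0)); first by rewrite expf_neq0 ?root_neq0.
by apply: h; rewrite mark_neq0.
Qed.

End Injectivity.
End Coefficients.
End PathCoefficients.

(** * The unit circle and H-th powers in polar form *)

Section UnitCircle.
Variable R : realType.
Implicit Types s t : R.

Lemma expjD s t : expj (s + t) = expj s * expj t.
Proof. by rewrite /expj cosD sinD [sin s * _ + _]addrC. Qed.

Lemma expj0 : expj (0 : R) = 1.
Proof. by rewrite /expj cos0 sin0. Qed.

Lemma conj_expj t : (expj t)^* = expj (- t).
Proof. by rewrite /expj cosN sinN. Qed.

Lemma expj_unit t : (expj t)^* * expj t = 1.
Proof. by rewrite conj_expj -expjD addNr expj0. Qed.

Lemma expjX t n : expj t ^+ n = expj (n%:R * t).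
Proof.
elim: n => [|n IH]; first by rewrite expr0 mul0r expj0.
by rewrite exprS IH -expjD -natr1 mulrDl mul1r addrC.
Qed.

Lemma norm_expj t : `|expj t| = 1.
Proof. by apply/eqP; rewrite -sqrp_eq1 // normCKC expj_unit. Qed.

Lemma expj_pi : expj (pi : R) = -1.
Proof. by rewrite /expj cospi sinpi; apply/eqP; rewrite eq_complex /= oppr0 !eqxx. Qed.

(** This follows from 1 - cos t = 2 sin(t / 2)^2, the sine being positive on ]0, pi[. *)
Lemma expj_eq1 t : expj t = 1 -> `|t| <= pi *+ 2 -> t = 0 \/ `|t| = pi *+ 2.
Proof.
case=> c1 _; have {}c1 : cos `|t| = 1 by rewrite cos_norm.
rewrite le_eqVlt => /orP[/eqP|lt]; first by right.
left; apply/eqP; rewrite -normr_eq0 eq_le normr_ge0 andbT leNgt; apply/negP => gt.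
have : 0 < sin (`|t| / 2) by apply: sin_gt0_pi; rewrite divr_gt0 // ltr_pdivrMr // mulr_natr.
have := cos_mulr2n (`|t| / 2); rewrite -[_ *+ 2]mulr_natr divfK ?pnatr_eq0 // c1 cos2sin2.
move=> e; suff : sin (`|t| / 2) ^+ 2 = 0 by move/eqP; rewrite sqrf_eq0 => /eqP ->; rewrite ltxx.
by rewrite mulr2n in e; lra.
Qed.

Lemma polar_expn_eq (H : nat) (r1 r2 t1 t2 : R) : (0 < H)%N -> 0 < r1 -> 0 < r2 ->
  (r1%:C%C * expj t1) ^+ H = (r2%:C%C * expj t2) ^+ H ->
  r1 = r2 /\ expj (H%:R * (t1 - t2)) = 1.
Proof.
move=> H0 r10 r20 e; have r12 : r1 = r2.
  apply: complexI; apply: (pexpIrn H0); rewrite ?nnegrE ?lecR ?ltW // ?ltcR //.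
  have nr (r : R) : 0 < r -> `|r%:C%C| = r%:C%C by move=> r0; rewrite ger0_norm // lecR ltW.
  by have := congr1 Num.norm e; rewrite !normrX !normrM !norm_expj !mulr1 !nr.
split=> //; move: e; rewrite r12 !exprMn => /mulfI.
rewrite expf_eq0 eq_complex /= (gt_eqF r20) !andbF => /(_ isT).
by rewrite !expjX mulrBr expjD => ->; rewrite -expjD subrr expj0.
Qed.

End UnitCircle.

(** * The constellation under rotations and reflection *)

Section ConstellationTheory.
Variables (R : realType) (H S : nat).
Variables (p : 'I_S -> R[i]) (r psi : 'I_S -> R).
Hypothesis H_gt0 : (0 < H)%N.
Hypothesis esc : equiangular_subsymmetric H p r psi.

Definition rootH : R[i] := expj (2 * pi / H%:R).

Let Hr_gt0 : 0 < H%:R :> R. Proof. by rewrite ltr0n. Qed.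
Let pi0 : 0 < pi :> R. Proof. exact: pi_gt0. Qed.

Lemma rootHX k : rootH ^+ k = expj (2 * pi * k%:R / H%:R).
Proof. by rewrite expjX; congr expj; rewrite mulrC mulrAC. Qed.

Lemma rootH_unit : rootH^* * rootH = 1.
Proof. exact: expj_unit. Qed.

Lemma rootH_order : rootH ^+ H = 1.
Proof.
rewrite rootHX -mulrA divff ?gt_eqF // mulr1.
by rewrite mulr_natl mulr2n expjD expj_pi mulrNN mulr1.
Qed.

Lemma rootH_inj k l : (k < H)%N -> (l < H)%N -> rootH ^+ k = rootH ^+ l -> k = l.
Proof.
wlog kl : k l / (k <= l)%N => [hw kH lH e|kH lH].
  by have [le|/ltnW le] := leqP k l; [exact: hw|apply/esym/hw].
rewrite -[in rootH ^+ l](subnK kl) exprD -[LHS]mul1r => /mulIf.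
rewrite expf_neq0 ?(root_neq0 rootH_unit) // => /(_ isT) /esym.
rewrite rootHX => /expj_eq1.
have d0 : 0 <= (l - k)%:R / H%:R :> R by rewrite divr_ge0 ?ler0n ?ltW.
have d1 : (l - k)%:R / H%:R < 1 :> R by rewrite ltr_pdivrMr // mul1r ltr_nat; lia.
have -> : `|2 * pi * (l - k)%:R / H%:R| = pi *+ 2 * ((l - k)%:R / H%:R) :> R.
  by rewrite -mulrA mulr_natl ger0_norm // mulr_ge0 // mulrn_wge0 ?ltW.
have pi2 : 0 < pi *+ 2 :> R by rewrite mulrn_wgt0.
rewrite -[X in _ <= X]mulr1 (ler_pM2l pi2) (ltW d1) => /(_ isT) [|e]; last first.
  move/eqP: e; rewrite -[X in _ == X]mulr1 (inj_eq (mulfI (lt0r_neq0 pi2))) => /eqP e1.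
  by rewrite e1 ltxx in d1.
move/eqP; rewrite -mulrA mulf_eq0 mulr_natl (gt_eqF pi2) /= mulf_eq0 invr_eq0.
by rewrite (gt_eqF Hr_gt0) orbF pnatr_eq0; lia.
Qed.

Lemma amplitude_gt0 u : 0 < r u.
Proof.
case: esc => _ /(_ u)[p0 pr] _ _ _.
by rewrite -ltcR -pr normr_gt0.
Qed.

Lemma esc_neq0 u : p u != 0.
Proof. by case: esc => _ /(_ u)[]. Qed.

Let psiH u : - pi < H%:R * psi u <= pi.
Proof.
case: esc => _ _ _ /(_ u)/andP[lo hi] _.
by rewrite -ltr_pdivrMl // -ler_pdivlMl // mulrN ![_^-1 * _]mulrC lo.
Qed.

(** The angles [H * psi] lie in ]- pi, pi], so two of them differ by less than 2 pi. *)
Lemma esc_expn_inj u v : p u ^+ H = p v ^+ H -> u = v.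
Proof.
case: (esc) => inj _ pE _ _; rewrite (pE u) (pE v).
case/(polar_expn_eq H_gt0 (amplitude_gt0 u) (amplitude_gt0 v)) => rr.
move=> /expj_eq1; have := psiH u; have := psiH v.
have -> : H%:R * (psi u + pi / 4 - (psi v + pi / 4)) = H%:R * psi u - H%:R * psi v by ring.
move=> /andP[v1 v2] /andP[u1 u2] e.
have lt : `|H%:R * psi u - H%:R * psi v| < pi *+ 2 by rewrite ltr_norml mulr2n; lra.
case: (e (ltW lt)) => [|e']; last by rewrite e' ltxx in lt.
rewrite -mulrBr => /eqP; rewrite mulf_eq0 (gt_eqF Hr_gt0) /= subr_eq0 => /eqP ee.
by apply: inj; rewrite (pE u) (pE v) rr ee.
Qed.

Lemma mirror_polar u : mirror (p u) = (r u)%:C%C * expj (pi / 4 - psi u).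
Proof.
case: (esc) => _ _ pE _ _; rewrite /mirror (pE u) rmorphM /= conj_expj.
have -> : 'i%C = expj (pi / 2) :> R[i] by rewrite /expj cos_pihalf sin_pihalf.
have -> : ((r u)%:C%C)^* = (r u)%:C%C :> R[i].
  by apply/eqP; rewrite eq_complex /= oppr0 !eqxx.
rewrite mulrCA -expjD; congr (_ * expj _); by field.
Qed.

(** Reflection negates [psi], so equal powers would make H (psi_u + psi_v) a multiple of 2 pi:
    either psi_u = - psi_v, or both equal pi / H. *)
Lemma mirror_expn_neq u v :
  (r u != r v) || ((r u == r v) && (`|psi u| != `|psi v|)) ->
  mirror (p v) ^+ H != p u ^+ H.
Proof.
move=> V; apply/eqP; case: (esc) => _ _ pE _ _; rewrite mirror_polar (pE u).
case/(polar_expn_eq H_gt0 (amplitude_gt0 v) (amplitude_gt0 u)) => rr.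
move: V; rewrite rr eqxx /= => ne.
move=> /expj_eq1; have := psiH u; have := psiH v.
have -> : H%:R * (pi / 4 - psi v - (psi u + pi / 4)) = - (H%:R * psi u + H%:R * psi v) by ring.
rewrite normrN => /andP[v1 v2] /andP[u1 u2] e.
have le : `|H%:R * psi u + H%:R * psi v| <= pi *+ 2 by rewrite ler_norml mulr2n; lra.
suff : `|H%:R * psi u| = `|H%:R * psi v|.
  rewrite !normrM => /mulfI; rewrite normr_eq0 (gt_eqF Hr_gt0) => /(_ isT) ee.
  by rewrite ee eqxx in ne.
case: (e le) => [/eqP|e'].
  by rewrite oppr_eq0 addr_eq0 => /eqP ->; rewrite normrN.
congr `|_|; move: e'; rewrite mulr2n; case: ler0P; lra.
Qed.

Lemma constellation_rootH z k : constellation H p z -> constellation H p (rootH ^+ k * z).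
Proof.
case=> u [l ->]; exists u, (Ordinal (ltn_pmod (k + l) H_gt0)).
rewrite -!rootHX mulrCA -exprD; congr (_ * _) => /=.
by rewrite [in LHS](divn_eq (k + l) H) exprD mulnC exprM rootH_order expr1n mul1r.
Qed.

Lemma constellation_gen u : constellation H p (p u).
Proof.
exists u, (Ordinal H_gt0); rewrite -rootHX expr0; exact/esym/mulr1.
Qed.

(** On the boundary psi = pi / H, where sub-symmetry says nothing, the mirror image is the rotation
    by - 2 pi / H, that is by [rootH ^+ H.-1]. *)
Lemma constellation_mirror u : constellation H p (mirror (p u)).
Proof.
case: (esc) => _ _ pE rng sym.
have [lt|ge] := ltP `|psi u| (pi / H%:R).
  by have [v pv] := sym u lt; rewrite /mirror -pv; exact: constellation_gen.
have /andP[u1 u2] := rng u.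
have psiE : psi u = pi / H%:R by move: ge u1 u2; case: ler0P; lra.
suff -> : mirror (p u) = rootH ^+ H.-1 * p u.
  exact/constellation_rootH/constellation_gen.
rewrite mirror_polar (pE u) rootHX mulrCA -expjD; congr (_ * _).
have -> : 2 * pi * H.-1%:R / H%:R + (psi u + pi / 4) = (pi / 4 - psi u) + 2 * pi * H%:R / H%:R.
  by rewrite psiE -subn1 natrB //; field; exact: lt0r_neq0.
by rewrite [RHS]expjD -rootHX rootH_order mulr1.
Qed.

Hypothesis H_even : ~~ odd H.

(** Through this the signs of the coefficients do not leave the constellation. *)
Lemma rootH_half : rootH ^+ H./2 = -1.
Proof.
rewrite rootHX -expj_pi; congr expj.
have -> : H%:R = 2 * (H./2)%:R :> R.
  by rewrite -natrM mul2n -[in LHS](odd_double_half H) (negbTE H_even).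
have : (H./2)%:R != 0 :> R by rewrite pnatr_eq0 -lt0n half_gt0; case: H H_gt0 H_even => [|[]].
by move=> h0; field.
Qed.

Lemma constellation_coef m (s : {perm 'I_m}) n u v k0 k x :
  constellation H p (coef rootH s n (p u) (p v) k0 k false x).
Proof.
rewrite /coef -mulrA; apply: constellation_rootH.
pose Q c := forall z, constellation H p z -> constellation H p (c * z).
have QM c d : Q c -> Q d -> Q (c * d).
  by move=> qc qd z cz; rewrite -mulrA; apply/qc/qd.
have : Q (\prod_(l < m) (bsign R (path_bit s x false l.+2) (path_bit s x false l.+1) *
    rootH ^+ (k l * path_bit s x false l.+1))).
  apply: big_ind => [z||l _]; [by rewrite mul1r | exact: QM | apply: QM].
    rewrite /bsign => z; rewrite -rootH_half -exprM; exact: constellation_rootH.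
  by move=> z; exact: constellation_rootH.
apply; rewrite /mark; case: ifP => _; case: ifP => _;
  by [exact: constellation_mirror | exact: constellation_gen].
Qed.

End ConstellationTheory.

(** * Counting permutations and marks *)

Lemma card_le_inj (T : finType) (U : Type) (D : {pred T}) (f : T -> U)
    (A : set U) n : (n <= #|D|)%N -> {in D &, injective f} ->
  (forall x, x \in D -> A (f x)) -> `I_n #<= A.
Proof.
(* Enumerating by [nth] needs a default in [D], hence the separate case n = 0. *)
move=> nD finj fA; have [->|n0] := posnP n; first by rewrite II0 card_ge0.
have /card_gt0P[x0 _] := leq_trans n0 nD.
pose g i := f (nth x0 (enum D) i).
have ltD i : `I_n i -> (i < size (enum D))%N by rewrite /= -cardE => /leq_trans; apply.
have gD i : `I_n i -> nth x0 (enum D) i \in D.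
  by move=> /ltD lt; rewrite -mem_enum mem_nth.
rewrite -(card_le_eql (inj_card_eq (f := g) _)); last first.
  move=> i j /set_mem iI /set_mem jI /(finj _ _ (gD _ iI) (gD _ jI))/eqP.
  by rewrite nth_uniq ?enum_uniq ?ltD // => /eqP.
by apply: subset_card_le => _ [i iI <-]; apply/fA/gD.
Qed.

(** Reversing the path swaps the values at its two ends, which differ as 1 < m; so exactly one of a
    permutation and its reversal counts. *)
Lemma card_ordered_ends m (o : 'I_m) : o = 0%N :> nat -> (1 < m)%N ->
  (#|[pred s : {perm 'I_m} | s o < s (rev_ord o)]| * 2 = m`!)%N.
Proof.
move=> o0 m1; rewrite -card_Sn muln2 -addnn -[in RHS]sum1_card.
rewrite -!sum1_card big_mkcond [in RHS]big_mkcond /=.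
rewrite [X in (_ + X)%N](reindex_inj (mulgI (perm (@rev_ord_inj m)))) -big_split /=.
apply: eq_bigr => s _; rewrite !inE !permM !permE rev_ordK.
have : s o != s (rev_ord o) by rewrite (inj_eq perm_inj) -val_eqE /= o0; lia.
by rewrite -val_eqE /=; case: ltngtP.
Qed.

Lemma card_offdiag S : #|[pred uv : 'I_S * 'I_S | uv.1 != uv.2]| = (S ^ 2 - S)%N.
Proof.
have := cardC [pred uv : 'I_S * 'I_S | uv.1 == uv.2].
rewrite card_prod card_ord (_ : #|[pred uv | _ == _]| = S) => [e|].
  by rewrite -mulnn -e addKn; apply: eq_card.
rewrite -[RHS]card_ord -(card_imset _ (f := fun u : 'I_S => (u, u))) => [|u v []//].
apply: eq_card => -[u v]; rewrite !inE /=.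
by apply/eqP/imsetP => [<-|[x _ [-> ->]]] //; exists u.
Qed.

(** n = 0 gives |D|, each of the m - 1 interior n gives S^2 - S, and n = m gives all S^2 pairs. *)
Lemma card_marks m S (D : pred ('I_S * 'I_S)) : (0 < m)%N ->
  #|[pred nuv : 'I_m.+1 * ('I_S * 'I_S) | if nuv.1 == 0%N :> nat then D nuv.2
     else (nuv.1 == m :> nat) || (nuv.2.1 != nuv.2.2)]|
  = ((S ^ 2 - S) * m + #|D| + S)%N.
Proof.
case: m => // m _; rewrite -sum1_card big_mkcond /=.
rewrite -(pair_bigA _ (fun (n : 'I_m.+2) uv =>
  if (n, uv) \in [pred nuv : 'I_m.+2 * ('I_S * 'I_S) | if nuv.1 == 0%N :> nat then D nuv.2
     else (nuv.1 == m.+1 :> nat) || (nuv.2.1 != nuv.2.2)] then 1 else 0)%N) /=.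
rewrite big_ord_recl big_ord_recr /=.
rewrite -big_mkcond sum1_card (eq_card (B := D)) //.
under eq_bigr => i _.
  rewrite -big_mkcond sum1_card (eq_card (B := [pred uv | uv.1 != uv.2])); last first.
    by move=> uv; rewrite !inE /= /bump /= add1n eqSS (ltn_eqF (ltn_ord i)).
  rewrite card_offdiag; over.
rewrite sum_nat_const card_ord [X in (_ + (_ + X))%N](_ : _ = S ^ 2)%N; last first.
  rewrite -big_mkcond sum1_card (eq_card (B := predT)) => [|uv].
    by rewrite card_prod card_ord mulnn.
  by rewrite !inE /= eqxx.
have : (S <= S ^ 2)%N by case: S {D} => // S; rewrite -mulnn leq_pmulr.
nia.
Qed.

(** * The parameter space and the two lower bounds *)

Section Parametrization.
Variables (R : realType) (H m S : nat).
Variables (p : 'I_S -> R[i]) (r psi : 'I_S -> R).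
Hypothesis (H_gt0 : (0 < H)%N) (H_even : ~~ odd H) (m_gt0 : (0 < m)%N).
Hypothesis esc : equiangular_subsymmetric H p r psi.

(** The path, the marked step with its two generators, and the m + 1 phases. *)
Definition param : finType :=
  ({perm 'I_m} * ('I_m.+1 * ('I_S * 'I_S)) * ('I_H * {ffun 'I_m -> 'I_H}))%type.

Definition exponent (K : {ffun 'I_m -> 'I_H}) (l : nat) : nat :=
  if insub l is Some a then K a : nat else 0.

Lemma exponent_ord K (a : 'I_m) : exponent K a = K a.
Proof. by rewrite /exponent valK. Qed.

Definition param_coef (t : param) (x : {ffun 'I_m -> bool}) : R[i] :=
  let: (pi, (n, (u, v)), (k0, K)) := t in
  coef (rootH R H) pi n (p u) (p v) k0 (exponent K) false x.

Definition param_seq N a b (t : param) : seq R[i] :=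
  let: (pi, (n, (u, v)), (k0, K)) := t in
  coef_seq (rootH R H) N a b pi n (p u) (p v) k0 (exponent K) false.

Definition param_valid (t : param) : bool :=
  valid_mark m H p t.1.2.1 t.1.2.2.1 t.1.2.2.2.

Definition first : 'I_m := Ordinal m_gt0.

Lemma param_coef_inj (t t' : param) : param_valid t -> param_valid t' ->
  t.1.1 first = t'.1.1 first \/
    ((t.1.1 first < t.1.1 (rev_ord first))%N /\
     (t'.1.1 first < t'.1.1 (rev_ord first))%N) ->
  (forall x, param_coef t x = param_coef t' x) -> t = t'.
Proof.
case: t => [[pi [n [u v]]] [k0 K]]; case: t' => [[pi' [n' [u' v']]] [k0' K']].
rewrite /param_valid /= => V V' orient e.
have [||||] := coef_inj (rootH_unit R H) (@rootH_order R H H_gt0)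
  (@rootH_inj R H H_gt0) (esc_neq0 esc) (esc_expn_inj H_gt0 esc)
  (k := exponent K) (k' := exponent K') (o := first)
  _ _ V V' (ltn_ord k0) (ltn_ord k0') _ _ e erefl orient.
- by rewrite -ltnS.
- by rewrite -ltnS.
- by move=> a; rewrite exponent_ord.
- by move=> a; rewrite exponent_ord.
move=> -> /val_inj -> -> -> [/val_inj -> eK]; congr (_, (_, _)).
by apply/ffunP => a; apply: val_inj; rewrite /= -!exponent_ord.
Qed.

Lemma param_seq_golay N a b (t : param) : (0 < N)%N ->
  (t.1.2.1 = 0%N :> nat -> N = 1%N) -> golay_pair N a b ->
  complementary (N * 2 ^ m) (param_seq N a b t).
Proof.
case: t => [[pi [n [u v]]] [k0 K]] /= N0 nN ab; eexists.
apply: coef_seq_golay => //; try exact: (esc_neq0 esc).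
  exact: rootH_unit.
by rewrite -ltnS.
Qed.

Lemma param_coef_constellation t x : constellation H p (param_coef t x).
Proof. by case: t => [[pi [n [u v]]] [k0 K]]; apply: (constellation_coef H_gt0 esc H_even). Qed.

Lemma param_seqE N a b t : param_seq N a b t =
  seq_of_family N (fun x i => param_coef t x * (if x (t.1.1 first) then b else a)`_i).
Proof.
case: t => [[pi [n [u v]]] [k0 K]]; rewrite /param_seq /coef_seq /=.
apply: eq_mkseq => k; congr (_ * (if _ then b else a)`_ _).
by rewrite /path_bit (ext_at_ord _ _ first) ffunE.
Qed.

Lemma card_param (A : {pred {perm 'I_m}}) (B : {pred 'I_m.+1 * ('I_S * 'I_S)}) :
  #|[pred t : param | (t.1.1 \in A) && (t.1.2 \in B)]| = (#|A| * #|B| * H ^ m.+1)%N.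
Proof.
rewrite (eq_card (B := [predX [predX A & B] & predT])) => [|t]; last by rewrite !inE andbT.
by rewrite !cardX card_prod card_ffun !card_ord expnS.
Qed.

Lemma param_seq_block N a b t : (0 < N)%N -> golay_pair N a b ->
  block_concatenation (constellation H p) a b (2 ^ m) (param_seq N a b t).
Proof.
move=> N0 [[sa _] [sb _] _].
exists [seq mkseq (fun i => param_coef t (bits m l) *
  (if bits m l (t.1.1 first) then b else a)`_i) N | l <- iota 0 (2 ^ m)]; split.
- by rewrite size_map size_iota.
- by rewrite param_seqE seq_of_family_flatten.
move=> x /mapP[l _ ->]; exists (param_coef t (bits m l)).
  exact: param_coef_constellation.
have blockE z y : size y = N -> mkseq (fun i => z * y`_i) N = [seq z * c | c <- y].
  move=> sy; rewrite -[in RHS](mkseq_nth 0 y) sy /mkseq -map_comp; exact: eq_map.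
by case: ifP => _; rewrite blockE //; [right|left].
Qed.

(** The seed for N = 1, which makes the entries of the sequence the coefficients themselves. *)
Lemma golay_pair_one : golay_pair 1 [:: 1 : R[i]] [:: 1].
Proof.
split; rewrite /is_sequence /= ?oner_eq0 //.
case=> [[|n]|n] // _; rewrite /autocorr /autocorr_nat /= subSS sub0n !big_ord0.
  exact: addr0.
by rewrite rmorph0 addr0.
Qed.

(** All m! paths count, since the blocks reveal the first bit of the path; n = 0 is left out, as
    marking the initial pair needs N = 1. *)
Lemma blocks_lower_bound N a b : (1 < N)%N -> golay_pair N a b ->
  (forall kappa : R[i], a <> [seq kappa * y | y <- b]) ->
  `I_((2 * ((S ^ 2 - S) * m + S) * golay_count m H)%N)
    #<= [set c : seq R[i] | complementary (N * 2 ^ m) c /\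
           block_concatenation (constellation H p) a b (2 ^ m) c].
Proof.
move=> N1 ab nab; have N0 := ltnW N1.
have [[sa a0] [sb b0] _] := ab.
pose B := [pred nuv : 'I_m.+1 * ('I_S * 'I_S) | if nuv.1 == 0%N :> nat then pred0 nuv.2
     else (nuv.1 == m :> nat) || (nuv.2.1 != nuv.2.2)].
have Bvalid t : t.1.2 \in B -> param_valid t /\ t.1.2.1 != 0%N :> nat.
  by rewrite !inE /param_valid /valid_mark; case: ifP.
apply: (card_le_inj (D := [pred t : param | (t.1.1 \in predT) && (t.1.2 \in B)])
  (f := param_seq N a b)).
- rewrite (card_param predT B) card_marks // card0 addn0 card_Sn.
  rewrite [X in (_ <= X)%N]mulnAC [X in (X * golay_count m H)%N]mulnC -mulnA.
  by rewrite [X in (X <= _)%N]mulnC leq_mul2r [(2 * golay_count _ _)%N]mulnC leq_trunc_div orbT.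
- move=> t t' /andP[_ /Bvalid[V _]] /andP[_ /Bvalid[V' _]].
  rewrite !param_seqE => /seq_of_family_inj e.
  (* Otherwise, at the block number whose only bit is the first one of [t'], one sequence has a
     multiple of [a] and the other a multiple of [b]. *)
  have efst : t.1.1 first = t'.1.1 first.
    apply/eqP/negPn/negP => ne.
    have eN i : (i < N)%N -> _ := e [ffun j => j == t'.1.1 first] i.
    rewrite !ffunE eqxx (negbTE ne) in eN.
    set c := param_coef t _ in eN; set c' := param_coef t' _ in eN.
    have c0 : c != 0 by rewrite /c; case: (t) => [[pi [n [u v]]] [k0 K]];
      apply: coef_neq0; rewrite ?rootH_unit ?(esc_neq0 esc).
    apply: (nab (c' / c)); apply: (@eq_from_nth _ 0) => [|i]; rewrite ?size_map sa ?sb // => iN.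
    rewrite (nth_map 0) ?sb //; apply: (mulfI c0); rewrite eN //.
    by rewrite mulrA mulrCA divff // mulr1.
  apply: param_coef_inj => // [|x]; first by left.
  have NN : (N.-1 < N)%N by rewrite ltn_predL.
  by have := e x _ NN; rewrite efst => /mulIf; apply; case: ifP.
move=> t /andP[_ /Bvalid[_ n0]]; split; last exact: param_seq_block.
by apply: param_seq_golay => // /eqP; rewrite (negbTE n0).
Qed.

(** Shared by m = 1 and m > 1, which use different sets [A] of paths and [B] of marks. *)
Lemma singletons_lower_bound n (A : {pred {perm 'I_m}}) (B : {pred 'I_m.+1 * ('I_S * 'I_S)}) :
  (n <= #|A| * #|B| * H ^ m.+1)%N ->
  (forall t : param, t.1.2 \in B -> param_valid t) ->
  (forall s s', s \in A -> s' \in A -> s first = s' first \/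
     ((s first < s (rev_ord first))%N /\ (s' first < s' (rev_ord first))%N)) ->
  `I_n #<= [set c : seq R[i] | complementary (2 ^ m) c /\
              forall x, x \in c -> constellation H p x].
Proof.
rewrite -card_param => card BV orient; apply: (card_le_inj card (f := param_seq 1 [:: 1] [:: 1])).
- move=> t t' /andP[tA /BV V] /andP[tA' /BV V'].
  rewrite !param_seqE => /seq_of_family_inj e.
  apply: param_coef_inj => // [|x]; first exact: orient.
  by have := e x 0%N isT; rewrite !if_same /= !mulr1.
move=> t _; split.
  by rewrite -[X in complementary X](mul1n (2 ^ m)%N); apply: param_seq_golay golay_pair_one.
move=> x; rewrite param_seqE => /mapP[l _ ->].
by rewrite if_same modn1 mulr1; exact: param_coef_constellation.
Qed.

Lemma elements_lower_bound :
  `I_((((S ^ 2 - S) * m + num_diff_amp r + num_diff_phase r psi + S)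
        * golay_count m H)%N)
    #<= [set c : seq R[i] | complementary (2 ^ m) c /\
           forall x, x \in c -> constellation H p x].
Proof.
pose D := [pred uv : 'I_S * 'I_S | (r uv.1 != r uv.2) ||
  ((r uv.1 == r uv.2) && (`|psi uv.1| != `|psi uv.2|))].
have cardD : (num_diff_amp r + num_diff_phase r psi = #|D|)%N.
  rewrite /num_diff_amp /num_diff_phase -cardUI addnC eq_card0 => [|uv].
    by apply: eq_card => uv; rewrite !inE.
  by rewrite !inE; case: eqP.
rewrite -[X in (X + S)%N]addnA cardD.
pose B (E : pred ('I_S * 'I_S)) := [pred nuv : 'I_m.+1 * ('I_S * 'I_S) |
  if nuv.1 == 0%N :> nat then E nuv.2 else (nuv.1 == m :> nat) || (nuv.2.1 != nuv.2.2)].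
(* For m = 1, where m`! / 2 is not an integer, the marks with n = m suffice. *)
have [m1|m1] := eqVneq m 1%N; last first.
  apply: (@singletons_lower_bound _ [pred s : {perm 'I_m} | (s first < s (rev_ord first))%N] (B D)).
  - have h2 := card_ordered_ends (erefl : first = 0%N :> nat); rewrite card_marks // /golay_count.
    (* m! is twice the number of normalized paths, so the division by 2 is exact. *)
    rewrite -h2; last by lia.
    by rewrite mulnAC mulnK // mulnCA mulnA.
  - move=> t; rewrite !inE /param_valid /valid_mark; case: ifP => // _ V.
    rewrite (mirror_expn_neq H_gt0 esc V) andbT (_ : (1 < m)%N); last by lia.
    by apply: contraTneq V => ->; rewrite !eqxx.
  - by move=> s s' As As'; right.
apply: (singletons_lower_bound (A := predT) (B := B pred0)).
- rewrite card_marks // card0 addn0 card_Sn -mulnA.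
  (* The claimed count is (S^2 + |D|) G with |D| at most S^2 and 2 G at most m! H^(m + 1), so the
     S^2 marks with n = 1 provide enough sequences. *)
  have Sle : (S <= S ^ 2)%N by case: (S) => // n; rewrite -mulnn leq_pmulr.
  have Dle : (#|D| <= S ^ 2)%N.
    by apply: leq_trans (max_card _) _; rewrite card_prod card_ord mulnn.
  have gG : (golay_count m H * 2 <= m`! * H ^ m.+1)%N := leq_trunc_div _ 2.
  have SE : ((S ^ 2 - S) * m + S = S ^ 2)%N by rewrite m1 muln1 subnK.
  rewrite addnAC SE mulnCA.
  apply: (@leq_trans (S ^ 2 * (golay_count m H * 2))); last by rewrite leq_mul2l gG orbT.
  by rewrite mulnA mulnAC leq_mul2r muln2 -addnn leq_add2l Dle orbT.
- by move=> t; rewrite !inE /param_valid /valid_mark; case: ifP.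
- move=> s s' _ _; left; apply: val_inj; move: (s first) (s' first) => /=; rewrite m1.
  by move=> i j; rewrite !ord1.
Qed.

End Parametrization.

Theorem corollary3 (R : realType) (H m S : nat)
    (p : 'I_S -> R[i]) (r psi : 'I_S -> R)
    (H_gt0 : (0 < H)%N) (H_even : ~~ odd H) (m_ge1 : (1 <= m)%N)
    (S_ge1 : (1 <= S)%N) (esc : equiangular_subsymmetric H p r psi) :
  `I_((((S ^ 2 - S) * m + num_diff_amp r + num_diff_phase r psi + S)
        * golay_count m H)%N)
    #<= [set c : seq R[i] | complementary (2 ^ m) c /\
           forall x, x \in c -> constellation H p x]
  /\
  forall (N : nat) (a b : seq R[i]), (1 < N)%N -> golay_pair N a b ->
    (forall kappa : R[i], a <> [seq kappa * y | y <- b]) ->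
    `I_((2 * ((S ^ 2 - S) * m + S) * golay_count m H)%N)
      #<= [set c : seq R[i] | complementary (N * 2 ^ m) c /\
             block_concatenation (constellation H p) a b (2 ^ m) c].
Proof.
split; first exact: elements_lower_bound esc.
by move=> N a b; exact: blocks_lower_bound esc _ _ _.
Qed.
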